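(* Let $(X,r)$ be a near-rack solution of the Yang-Baxter equation with $X$ finite, $r(x,y)=(\sigma_x(y),\tau(x))$, and let $(W_{X,r},c)$ be a braided vector space associated to $(X,r)$, with basis $(w_i)_{i\in X}$ and $c(w_i\otimes w_j)=R_{i,j}\,w_{\sigma_i(j)}\otimes w_{\tau(i)}$, $R_{i,j}\in\Bbbk^\times$. Let $z_i\in\Bbbk^\times$ for $i\in X$ and define the invertible linear map $\varphi: W_{X,r}\to W_{X,r}$ by $\varphi(w_i)=z_i w_{\tau(i)}$ for all $i\in X$. Then $$(\varphi^{-1}\otimes \mathrm{id})\,c\,(\varphi\otimes\mathrm{id})=(\mathrm{id}\otimes\varphi^{-1})\,c\,(\mathrm{id}\otimes\varphi)$$ if and only if $$z_i^2=z_j\,z_{\sigma_i\tau(j)}\,\frac{R_{i,\tau(j)}}{R_{\tau(i),j}}\qquad\text{for all } i,j\in X.$$ In other words, if there exist non-zero parameters $z_i$ ($i\in X$) satisfying these equations, then, with $\tilde c=(\varphi^{-1}\otimes \mathrm{id})c(\varphi\otimes\mathrm{id})=(\mathrm{id}\otimes\varphi^{-1})c(\mathrm{id}\otimes\varphi)$, the braided vector space $(W_{X,r},c)$ is t-equivalent to $(W_{X,\tilde r},\tilde c)$, which is of rack type, where $(X,\tilde r)$ is the derived solution of $(X,r)$ and $W_{X,r}=W_{X,\tilde r}$ as vector spaces.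
   Context: $\Bbbk$ is an algebraically closed field of characteristic $0$ and $\Bbbk^\times=\Bbbk\setminus\{0\}$. A set-theoretical solution of the Yang-Baxter equation is a pair $(X,r)$ with $X$ a non-empty set and $r:X\times X\to X\times X$ a bijection satisfying $(r\times \mathrm{id})(\mathrm{id}\times r)(r\times \mathrm{id})=(\mathrm{id}\times r)(r\times \mathrm{id})(\mathrm{id}\times r)$; write $r(x,y)=(\sigma_x(y),\tau_y(x))$. It is non-degenerate if all $\sigma_x,\tau_x:X\to X$ are bijective. A near-rack solution is a non-degenerate solution for which $\tau_y=\tau$ is independent of $y\in X$, $\tau\neq\mathrm{id}$ and $\tau^2=\mathrm{id}$; so $r(x,y)=(\sigma_x(y),\tau(x))$. Derived solution: for a non-degenerate solution $(X,r)$ put $T(x,y)=(\tau_y(x),y)$; the derived solution is $(X,\tilde r)$ with $\tilde r=TrT^{-1}$. It has the form $\tilde r(x,y)=(x\rhd y,x)$, where $(X,\rhd)$ is a rack, i.e. each map $y\mapsto x\rhd y$ is bijective and $x\rhd(y\rhd z)=(x\rhd y)\rhd(x\rhd z)$. A braided vector space $(V,c)$ is a vector space $V$ with a linear isomorphism $c:V\otimes V\to V\otimes V$ satisfying $(c\otimes\mathrm{id})(\mathrm{id}\otimes c)(c\otimes\mathrm{id})=(\mathrm{id}\otimes c)(c\otimes\mathrm{id})(\mathrm{id}\otimes c)$. For a near-rack solution $(X,r)$ with $X$ finite, a braided vector space $(W_{X,r},c)$ associated to $(X,r)$ is $W_{X,r}=\bigoplus_{i\in X}\Bbbk w_i$ with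 $c(w_i\otimes w_j)=R_{i,j}w_{\sigma_i(j)}\otimes w_{\tau(i)}$, where the scalars $R_{i,j}\in\Bbbk^\times$ satisfy $$R_{i,j}R_{\tau(i),k}R_{\sigma_i(j),\sigma_{\tau(i)}(k)}=R_{j,k}R_{i,\sigma_j(k)}R_{\tau(i),\tau(j)}\quad\text{for all } i,j,k\in X.$$ A braided vector space $(W_{X,\tilde r},\tilde c)$ associated to the derived solution (said to be of rack type) is $\bigoplus_{i\in X}\Bbbk w_i$ with a braiding of the form $\tilde c(w_i\otimes w_j)=q_{ij}\,w_{i\rhd j}\otimes w_i$, $q_{ij}\in\Bbbk^\times$. Two braided vector spaces $(V,c)$ and $(W,\tilde c)$ are t-equivalent if there are linear isomorphisms $U_n:V^{\otimes n}\to W^{\otimes n}$ for all $n\ge 2$ intertwining the representations of the braid group $\mathbb B_n$ on $V^{\otimes n}$ and $W^{\otimes n}$ given by $c$ and $\tilde c$ (the $i$-th standard generator acts by the braiding on tensor factors $i,i+1$). *)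

(* Defs.v *)
From HB Require Import structures.
From mathcomp Require Import all_boot all_order all_algebra.

Set Implicit Arguments.
Unset Strict Implicit.
Unset Printing Implicit Defensive.

Import GRing.Theory.
Local Open Scope ring_scope.

Definition r_id (X : Type) (r : X * X -> X * X) (p : X * X * X) : X * X * X :=
  let: (x, y, z) := p in let: (x', y') := r (x, y) in (x', y', z).

Definition id_r (X : Type) (r : X * X -> X * X) (p : X * X * X) : X * X * X :=
  let: (x, y, z) := p in let: (y', z') := r (y, z) in (x, y', z').

Record YB_solution (X : Type) (r : X * X -> X * X) : Prop := YBSolution {
  YB_inhabited : inhabited X;
  YB_bij : bijective r;
  YB_eq : r_id r \o id_r r \o r_id r =1 id_r r \o r_id r \o id_r r
}.

(* r (x, y) = (sigma_x y, tau_y x) *)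
Definition sigma (X : Type) (r : X * X -> X * X) (x y : X) : X := (r (x, y)).1.
Definition tau (X : Type) (r : X * X -> X * X) (y x : X) : X := (r (x, y)).2.

Definition nondegenerate (X : Type) (r : X * X -> X * X) : Prop :=
  (forall x, bijective (sigma r x)) /\ (forall y, bijective (tau r y)).

Record near_rack_solution (X : Type) (r : X * X -> X * X) (t : X -> X) : Prop :=
  NearRackSolution {
    near_rack_YB : YB_solution r;
    near_rack_nondeg : nondegenerate r;
    near_rack_tau : forall y, tau r y =1 t;
    near_rack_neq_id : ~ (t =1 id);
    near_rack_involutive : involutive t
  }.

Definition rack (X : Type) (rhd : X -> X -> X) : Prop :=
  (forall x, bijective (rhd x)) /\
  (forall x y z, rhd x (rhd y z) = rhd (rhd x y) (rhd x z)).

Definition derived_T (X : Type) (r : X * X -> X * X) (p : X * X) : X * X :=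
  (tau r p.2 p.1, p.2).

(* T r T^-1; [finv f] is the inverse of f when f is injective, which is the
   case of T when r is non-degenerate. *)
Definition derived (X : finType) (r : X * X -> X * X) : X * X -> X * X :=
  derived_T r \o r \o finv (derived_T r).

Lemma derived_T_inj (X : Type) (r : X * X -> X * X) :
  nondegenerate r -> injective (derived_T r).
Proof.
by move=> [_ bt] [x y] [x' y'] [/= + eyy]; rewrite -eyy => /(bij_inj (bt y)) ->.
Qed.

(* The space with basis A is k^A.  Tensor products are taken in coordinates:
   k^A (x) k^B is k^(A * B), and the n-th tensor power of k^A is k^(A^n) with
   A^n the set of maps 'I_n -> A.  The regular module k^o is used since it, and
   not k itself, carries the canonical vectType structure. *)
Notation "k '^[' A ]" := ({ffun A -> k^o}) (at level 2, A at level 99,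
  format "k '^[' A ]") : type_scope.

Notation tpow A n := {ffun 'I_n -> A}.

Section FreeSpaces.
Variable k : fieldType.

Definition bvec (A : finType) (a : A) : k^[A] := [ffun x => (x == a)%:R].

Definition pure (A B : finType) (u : k^[A]) (v : k^[B]) : k^[A * B] :=
  [ffun p => u p.1 * v p.2].

Definition pure_pow (A : finType) (n : nat) (u : 'I_n -> k^[A]) :
    k^[tpow A n] :=
  [ffun s : tpow A n => \prod_(i < n) u i (s i)].

Lemma bvec_pair (A B : finType) (a : A) (b : B) :
  bvec (a, b) = pure (bvec a) (bvec b).
Proof.
apply/ffunP=> -[x y]; rewrite !ffunE /= xpair_eqE.
by case: eqP; case: eqP; rewrite ?mulr1 ?mulr0.
Qed.

Lemma bvec_pow (A : finType) (n : nat) (s : tpow A n) :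
  bvec s = pure_pow (fun i => bvec (s i)).
Proof.
apply/ffunP=> x; rewrite !ffunE; case: eqP => [->|/eqP nx].
  by rewrite big1 // => i _; rewrite ffunE eqxx.
have [i ni] : exists i, x i != s i.
  apply/existsP; rewrite -negb_forall; apply: contra nx => /forallP e.
  by apply/eqP/ffunP => i; apply/eqP.
by rewrite (bigD1 i) //= ffunE (negPf ni) mul0r.
Qed.

Lemma bvec_sum (A : finType) (u : k^[A]) : u = \sum_a u a *: bvec a.
Proof.
apply/ffunP=> x; rewrite sum_ffunE (bigD1 x) //= !ffunE eqxx big1 ?addr0.
  by rewrite /GRing.scale /= mulr1.
by move=> a /negPf nax; rewrite !ffunE eq_sym nax /GRing.scale /= mulr0.
Qed.

(* The linear map with prescribed values on the basis. *)
Definition lin_ext (A : finType) (V : vectType k) (e : A -> V) :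
    'Hom(k^[A], V) :=
  linfun (fun u : k^[A] => \sum_a (u a : k) *: e a).

Lemma lin_extE (A : finType) (V : vectType k) (e : A -> V) u :
  lin_ext e u = \sum_a (u a : k) *: e a.
Proof.
pose f (u : k^[A]) := \sum_a (u a : k) *: e a.
have fl : linear f.
  move=> c v w; rewrite /f scaler_sumr -big_split; apply: eq_bigr => a _ /=.
  by rewrite !ffunE scalerDl scalerA.
pose F := GRing.isLinear.Build _ _ _ _ f fl.
pose L : {linear k^[A] -> V} := HB.pack f F.
exact: (lfunE L).
Qed.

Lemma lin_ext_bvec (A : finType) (V : vectType k) (e : A -> V) a :
  lin_ext e (bvec a) = e a.
Proof.
rewrite lin_extE (bigD1 a) //= ffunE eqxx scale1r big1 ?addr0 // => b /negPf nb.
by rewrite ffunE nb scale0r.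
Qed.

Lemma eq_lin_bvec (A : finType) (V : vectType k) (f g : 'Hom(k^[A], V)) :
  (forall a, f (bvec a) = g (bvec a)) -> f = g.
Proof.
move=> e; apply/lfunP=> u; rewrite (bvec_sum u) !linear_sum.
by apply: eq_bigr => a _; rewrite !linearZ_LR /= e.
Qed.

Definition tensor_map (A B C D : finType)
    (f : 'Hom(k^[A], k^[C])) (g : 'Hom(k^[B], k^[D])) :
    'Hom(k^[A * B], k^[C * D]) :=
  lin_ext (fun p => pure (f (bvec p.1)) (g (bvec p.2))).

Lemma tensor_map_pure (A B C D : finType)
    (f : 'Hom(k^[A], k^[C])) (g : 'Hom(k^[B], k^[D])) u v :
  tensor_map f g (pure u v) = pure (f u) (g v).
Proof.
apply/ffunP=> -[c d]; rewrite lin_extE sum_ffunE.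
pose F a b : k := (u a * f (bvec a) c) * (v b * g (bvec b) d).
transitivity (\sum_p F p.1 p.2).
  by apply: eq_bigr => p _; rewrite !ffunE /GRing.scale /= mulrACA.
rewrite -(pair_bigA _ F) [in RHS](bvec_sum u) [in RHS](bvec_sum v) !linear_sum.
rewrite !ffunE !sum_ffunE mulr_suml; apply: eq_bigr => a _.
rewrite mulr_sumr; apply: eq_bigr => b _.
by rewrite !linearZ_LR !ffunE.
Qed.

Definition update2 (A : finType) (n : nat) (i j : 'I_n) (s : tpow A n)
    (p : A * A) : tpow A n :=
  [ffun l => if l == i then p.1 else if l == j then p.2 else s l].

(* c acting on the tensor factors i and j (in this order), the other factors
   being left unchanged. *)
Definition act_at (A : finType) (c : 'End(k^[A * A])) (n : nat)
    (i j : 'I_n) : 'End(k^[tpow A n]) :=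
  lin_ext (fun s : tpow A n =>
    \sum_p (c (bvec (s i, s j)) p : k) *: bvec (update2 i j s p)).

Lemma ltn_predS (n : nat) (i : 'I_n.-1) : (i.+1 < n)%N.
Proof. by case: n i => [|n] [i lti]. Qed.

(* The i-th standard generator, i = 0, ..., n - 2, acts on the factors i and
   i + 1, factors being numbered from 0. *)
Definition gen (A : finType) (c : 'End(k^[A * A])) (n : nat) (i : 'I_n.-1) :
    'End(k^[tpow A n]) :=
  act_at c (widen_ord (leq_pred n) i) (Ordinal (ltn_predS i)).

Definition braiding (A : finType) (c : 'End(k^[A * A])) : Prop :=
  let c12 := gen c (ord0 : 'I_3.-1) in
  let c23 := gen c (ord_max : 'I_3.-1) in
  bijective c /\ (c12 \o c23 \o c12 = c23 \o c12 \o c23)%VF.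

(* A word in the standard generators of the braid group B_n (paired with true)
   and their inverses (paired with false); every element of B_n is represented
   by such a word. *)
Definition braid_word (n : nat) := seq ('I_n.-1 * bool).

(* [f^-1]%VF is the inverse of f when f is bijective, which is the case of the
   [gen c i] when c is bijective. *)
Definition braid_rep (A : finType) (c : 'End(k^[A * A])) (n : nat)
    (b : braid_word n) : 'End(k^[tpow A n]) :=
  foldr (fun l f => ((if l.2 then gen c l.1 else (gen c l.1)^-1) \o f)%VF)
    \1%VF b.

Definition t_equivalent (A B : finType)
    (c : 'End(k^[A * A])) (d : 'End(k^[B * B])) : Prop :=
  [/\ braiding c, braiding d &
      forall n, (2 <= n)%N ->
        exists2 U : 'Hom(k^[tpow A n], k^[tpow B n]), bijective U &
          forall b : braid_word n,
            (U \o braid_rep c b = braid_rep d b \o U)%VF].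

Record near_rack_braiding (X : finType) (r : X * X -> X * X) (t : X -> X)
    (R : X -> X -> k) (c : 'End(k^[X * X])) : Prop := NearRackBraiding {
  near_rack_braiding_neq0 : forall i j, R i j != 0;
  near_rack_braiding_cocycle : forall i j l,
    R i j * R (t i) l * R (sigma r i j) (sigma r (t i) l) =
    R j l * R i (sigma r j l) * R (t i) (t j);
  near_rack_braidingE : forall i j,
    c (pure (bvec i) (bvec j)) =
      R i j *: pure (bvec (sigma r i j)) (bvec (t i))
}.

Definition rack_type_braiding (X : finType) (s : X * X -> X * X)
    (c : 'End(k^[X * X])) : Prop :=
  braiding c /\
  exists (rhd : X -> X -> X) (q : X -> X -> k),
    [/\ rack rhd,
        forall x y, s (x, y) = (rhd x y, x),
        forall i j, q i j != 0 &
        forall i j,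
          c (pure (bvec i) (bvec j)) = q i j *: pure (bvec (rhd i j)) (bvec i)].

Definition twist (X : finType) (t : X -> X) (z : X -> k) : 'End(k^[X]) :=
  lin_ext (fun i => z i *: bvec (t i)).

(* (f^-1 (x) id) c (f (x) id) and (id (x) f^-1) c (id (x) f); the inverse is
   genuine only when f is bijective. *)
Definition conj_left (X : finType) (f : 'End(k^[X])) (c : 'End(k^[X * X])) :
    'End(k^[X * X]) :=
  (tensor_map f^-1 \1 \o c \o tensor_map f \1)%VF.

Definition conj_right (X : finType) (f : 'End(k^[X])) (c : 'End(k^[X * X])) :
    'End(k^[X * X]) :=
  (tensor_map \1 f^-1 \o c \o tensor_map \1 f)%VF.

End FreeSpaces.

(* Main.v *)
Require Import Defs.
From mathcomp Require Import all_boot all_order all_algebra.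
Import GRing.Theory.
Local Open Scope ring_scope.

Set Implicit Arguments.
Unset Strict Implicit.
Unset Printing Implicit Defensive.

(** Write [d] for the common value of the two conjugates of the braiding [c] by
    an invertible [f], i.e. [d = (f^-1 (x) 1) c (f (x) 1)] and
    [d = (1 (x) f^-1) c (1 (x) f)].  Then both [f^-1 (x) 1] and [1 (x) f^-1]
    intertwine [c] with [d].  In the alternating product
    [U_n = f^-1 (x) 1 (x) f^-1 (x) 1 (x) ...], any two neighbouring factors
    are, in order, [f^-1] and [1] or [1] and [f^-1]; hence [U_n] intertwines
    every standard generator, whatever the parity of its position.  This gives
    t-equivalence for an arbitrary braided vector space
    ([conj_t_equivalent]).  That [d] satisfies the braid equation is not checked
    directly: it is transported from [c] along [U_3].

    For a near-rack solution with [f = phi : w_i |-> z_i w_(t i)], the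
    Yang-Baxter equation for [r] says
    [sigma_x sigma_y = sigma_(sigma_x y) sigma_(t x)] and
    [t sigma_x = sigma_(t x) t].  The second identity shows that both conjugates
    send [w_i (x) w_j] to a multiple of [w_(sigma_i (t j)) (x) w_i], with
    coefficients [z_i R_(t i, j) / z_(sigma_i (t j))] and
    [z_j R_(i, t j) / z_i]; equating them gives the equations on [z].  The same
    two identities show that [i |> j = sigma_i (t j)] is a rack operation and
    that it is the one of the derived solution.  Finally, [c] itself is a
    braiding, since it permutes the basis of the tensor square by [r] up to
    scalars, and the condition on [R] is what the braid equation requires of
    these scalars ([monomial_braiding]). *)

(** * Invertible endomorphisms *)

Lemma bij_lker0 (k : fieldType) (V : vectType k) (f : 'End(V)) :
  bijective f -> lker f == 0%VS.
Proof. by move=> bf; apply/lker0P/bij_inj. Qed.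

Lemma lfun_cancel_bij (k : fieldType) (V : vectType k) (f g : 'End(V)) :
  (f \o g = \1 -> g \o f = \1 -> bijective f)%VF.
Proof.
move=> fg gf; exists g => v.
  by rewrite -comp_lfunE gf id_lfunE.
by rewrite -comp_lfunE fg id_lfunE.
Qed.

Lemma lfun_inv_bij (k : fieldType) (V : vectType k) (f : 'End(V)) :
  bijective f -> bijective (f^-1)%VF.
Proof.
move=> /bij_lker0 f0.
by apply: (@lfun_cancel_bij _ _ _ f); [exact: lker0_compVf|exact: lker0_compfV].
Qed.

Lemma intertwine_inv (k : fieldType) (V : vectType k) (u f g : 'End(V)) :
    bijective f -> bijective g ->
  (u \o f = g \o u -> u \o f^-1 = g^-1 \o u)%VF.
Proof.
move=> /bij_lker0 f0 /bij_lker0 g0 e.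
rewrite -[LHS]comp_lfun1l -(lker0_compVf g0) -comp_lfunA.
by rewrite (comp_lfunA g) -e -comp_lfunA (lker0_compfV f0) comp_lfun1r.
Qed.

(** * Tensor products of linear maps *)

Section Tensor.
Variable k : fieldType.

Lemma scale_bvec_inj (A : finType) (p : A) (a b : k) :
  a *: bvec k p = b *: bvec k p -> a = b.
Proof.
by move=> /ffunP/(_ p); rewrite !ffunE eqxx /GRing.scale /= !mulr1.
Qed.

Lemma pureZ (A B : finType) (a b : k) (u : k^[A]) (v : k^[B]) :
  pure (a *: u) (b *: v) = (a * b) *: pure u v.
Proof. by apply/ffunP=> x; rewrite !ffunE /GRing.scale /= mulrACA. Qed.

Lemma pureZl (A B : finType) (a : k) (u : k^[A]) (v : k^[B]) :
  pure (a *: u) v = a *: pure u v.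
Proof. by rewrite -[v in LHS]scale1r pureZ mulr1. Qed.

Lemma pureZr (A B : finType) (a : k) (u : k^[A]) (v : k^[B]) :
  pure u (a *: v) = a *: pure u v.
Proof. by rewrite -[u in LHS]scale1r pureZ mul1r. Qed.

(** The inverse sends the basis vector at [a] to the one at [p^-1 a], divided by
    the scalar that [f] attaches there. *)
Lemma monomial_bij (A : finType) (f : 'End(k^[A])) (w : A -> k) (p : A -> A) :
    bijective p -> (forall a, w a != 0) ->
  (forall a, f (bvec k a) = w a *: bvec k (p a)) -> bijective f.
Proof.
move=> [q pK qK] w0 fE.
pose g : 'End(k^[A]) := lin_ext (fun a => (w (q a))^-1 *: bvec k (q a)).
have gE a : g (bvec k a) = (w (q a))^-1 *: bvec k (q a) by exact: lin_ext_bvec.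
apply: (@lfun_cancel_bij _ _ _ g); apply: eq_lin_bvec => a;
  rewrite comp_lfunE id_lfunE.
  by rewrite gE linearZ_LR /= fE qK scalerA mulVf ?scale1r.
by rewrite fE linearZ_LR /= gE pK scalerA mulfV ?scale1r.
Qed.

Lemma tensor_map_comp (A B : finType) (f f' : 'End(k^[A])) (g g' : 'End(k^[B])) :
  (tensor_map f g \o tensor_map f' g' = tensor_map (f \o f') (g \o g'))%VF.
Proof.
apply: eq_lin_bvec => -[a b].
by rewrite comp_lfunE bvec_pair !tensor_map_pure !comp_lfunE.
Qed.

Lemma tensor_map1 (A B : finType) :
  tensor_map (\1 : 'End(k^[A])) (\1 : 'End(k^[B])) = \1%VF.
Proof.
apply: eq_lin_bvec => -[a b].
by rewrite id_lfunE bvec_pair tensor_map_pure !id_lfunE.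
Qed.

Lemma tensor_map_bij (A B : finType) (f : 'End(k^[A])) (g : 'End(k^[B])) :
  bijective f -> bijective g -> bijective (tensor_map f g).
Proof.
move=> /bij_lker0 f0 /bij_lker0 g0.
apply: (@lfun_cancel_bij _ _ _ (tensor_map f^-1 g^-1)).
  by rewrite tensor_map_comp !lker0_compfV ?tensor_map1.
by rewrite tensor_map_comp !lker0_compVf ?tensor_map1.
Qed.

Definition tensor_pow (A : finType) (n : nat) (f : 'I_n -> 'End(k^[A])) :
    'End(k^[tpow A n]) :=
  lin_ext (fun s : tpow A n => pure_pow (fun l => f l (bvec k (s l)))).

Lemma tensor_pow_bvec (A : finType) (n : nat) (f : 'I_n -> 'End(k^[A])) s :
  tensor_pow f (bvec k s) = pure_pow (fun l => f l (bvec k (s l))).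
Proof. exact: lin_ext_bvec. Qed.

(** The entry at [x] of both sides is a product over the factors of sums over the
    basis; distributing it gives the sum over all basis tensors that defines the
    left-hand side. *)
Lemma tensor_pow_pure (A : finType) (n : nat) (f : 'I_n -> 'End(k^[A]))
    (u : 'I_n -> k^[A]) :
  tensor_pow f (pure_pow u) = pure_pow (fun l => f l (u l)).
Proof.
apply/ffunP=> x; rewrite lin_extE sum_ffunE !ffunE.
transitivity (\prod_(l < n) \sum_a (u l a * f l (bvec k a) (x l) : k)).
  rewrite bigA_distr_bigA; apply: eq_bigr => s _.
  by rewrite !ffunE /GRing.scale /= -big_split.
apply: eq_bigr => l _; rewrite [in RHS](bvec_sum (u l)) linear_sum sum_ffunE.
by apply: eq_bigr => a _; rewrite linearZ_LR ffunE.
Qed.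

Lemma tensor_pow_bij (A : finType) (n : nat) (f : 'I_n -> 'End(k^[A])) :
  (forall l, bijective (f l)) -> bijective (tensor_pow f).
Proof.
move=> bf; apply: (@lfun_cancel_bij _ _ _ (tensor_pow (fun l => (f l)^-1)%VF));
  apply: eq_lin_bvec => s;
  rewrite comp_lfunE bvec_pow !tensor_pow_pure id_lfunE;
  apply/ffunP=> x; rewrite !ffunE; apply: eq_bigr => l _.
  by rewrite lker0_lfunVK ?bij_lker0.
by rewrite lker0_lfunK ?bij_lker0.
Qed.

(** * Braidings acting on two tensor factors *)

Section TwoFactors.
Variables (A : finType) (n : nat) (i j : 'I_n).
Hypothesis neq_ij : i != j.

Lemma update2_l (s : tpow A n) p : update2 i j s p i = p.1.
Proof. by rewrite ffunE eqxx. Qed.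

Lemma update2_r (s : tpow A n) p : update2 i j s p j = p.2.
Proof. by rewrite ffunE eq_sym (negPf neq_ij) eqxx. Qed.

Lemma update2_id (s : tpow A n) : update2 i j s (s i, s j) = s.
Proof. by apply/ffunP=> l; rewrite ffunE; do 2?[case: eqP => [->//|_]]. Qed.

Lemma update2K (s : tpow A n) p q :
  update2 i j (update2 i j s p) q = update2 i j s q.
Proof. by apply/ffunP=> l; rewrite !ffunE; do 2?[case: eqP => // _]. Qed.

(** The tensor [v] seen as a function of its coordinates [i] and [j] only, the
    others being those of [x]. *)
Definition slice (v : k^[tpow A n]) (x : tpow A n) : k^[A * A] :=
  [ffun q => v (update2 i j x q)].

(** An entry of the action on the factors [i] and [j] is the corresponding entry
    of [c] applied to a slice: of the basis tensors [s] only those agreeing with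
    [x] off [i] and [j] contribute, and these are the [update2 i j x p].  In this
    form functoriality in [c] is immediate. *)
Lemma act_atE (c : 'End(k^[A * A])) (v : k^[tpow A n]) (x : tpow A n) :
  act_at c i j v x = c (slice v x) (x i, x j).
Proof.
rewrite lin_extE sum_ffunE (bvec_sum (slice v x)) linear_sum sum_ffunE.
have E (s : tpow A n) :
  (v s *: (\sum_p (c (bvec k (s i, s j)) p : k) *: bvec k (update2 i j s p))) x
  = if update2 i j x (s i, s j) == s then
      (v s * c (bvec k (s i, s j)) (x i, x j) : k) else 0.
  rewrite ffunE sum_ffunE; case: eqP => [e|ne].
    rewrite (bigD1 (x i, x j)) //= big1 => [|p np]; rewrite !ffunE.
      by rewrite addr0 -e update2K update2_id !eqxx /GRing.scale /= mulr1.
    case: eqP => [ex|_]; last by rewrite scaler0.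
    by case/eqP: np; rewrite ex update2_l update2_r -surjective_pairing.
  rewrite big1 ?scaler0 // => p _; rewrite !ffunE.
  case: eqP => [ex|_]; last by rewrite scaler0.
  by case: ne; rewrite ex update2K update2_id.
rewrite (eq_bigr _ (fun s _ => E s)) -big_mkcond /=.
rewrite (reindex_onto (update2 i j x) (fun s => (s i, s j))) /=; last first.
  by move=> s /eqP.
apply: eq_big => [p|p _].
  by rewrite update2_l update2_r -surjective_pairing !eqxx.
rewrite update2_l update2_r -surjective_pairing linearZ_LR.
by rewrite [RHS]ffunE [slice v x p]ffunE.
Qed.

Lemma act_at_comp (c d : 'End(k^[A * A])) :
  (act_at c i j \o act_at d i j = act_at (c \o d) i j)%VF.
Proof.
apply/lfunP=> v; apply/ffunP=> x; rewrite comp_lfunE !act_atE comp_lfunE.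
congr (c _ _); apply/ffunP=> q; rewrite ffunE act_atE update2_l update2_r.
rewrite -surjective_pairing; congr (d _ _).
by apply/ffunP=> q'; rewrite !ffunE update2K.
Qed.

Lemma act_at1 : act_at (\1 : 'End(k^[A * A])) i j = \1%VF.
Proof.
apply/lfunP=> v; apply/ffunP=> x.
by rewrite act_atE !id_lfunE ffunE update2_id.
Qed.

Lemma act_at_bij (c : 'End(k^[A * A])) : bijective c -> bijective (act_at c i j).
Proof.
move=> /bij_lker0 c0; apply: (@lfun_cancel_bij _ _ _ (act_at c^-1 i j)).
  by rewrite act_at_comp lker0_compfV ?act_at1.
by rewrite act_at_comp lker0_compVf ?act_at1.
Qed.

Lemma pure_pow_split (u : 'I_n -> k^[A]) (x : tpow A n) :
  pure_pow u x =
    (\prod_(l | (l != i) && (l != j)) u l (x l)) * pure (u i) (u j) (x i, x j).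
Proof.
by rewrite !ffunE (bigD1 i) //= (bigD1 j) 1?eq_sym //= mulrA mulrC.
Qed.

(** Off the factors [i] and [j] both sides apply each [f l] to the [l]-th factor,
    which contributes the common scalar [P] to an entry; what remains is the
    hypothesis on two factors. *)
Lemma act_at_intertwine (c d : 'End(k^[A * A])) (f : 'I_n -> 'End(k^[A])) :
    (tensor_map (f i) (f j) \o c = d \o tensor_map (f i) (f j))%VF ->
  (tensor_pow f \o act_at c i j = act_at d i j \o tensor_pow f)%VF.
Proof.
move=> e; apply: eq_lin_bvec => s; rewrite !comp_lfunE.
apply/ffunP=> x; rewrite act_atE.
pose P : k := \prod_(l | (l != i) && (l != j)) f l (bvec k (s l)) (x l).
transitivity (P * tensor_map (f i) (f j) (c (bvec k (s i, s j))) (x i, x j)).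
  rewrite lin_ext_bvec linear_sum sum_ffunE.
  rewrite lin_extE sum_ffunE mulr_sumr; apply: eq_bigr => p _.
  rewrite linearZ_LR /= tensor_pow_bvec ffunE pure_pow_split update2_l update2_r.
  rewrite !ffunE /GRing.scale /= mulrCA; congr (_ * (_ * _)).
  by apply: eq_bigr => l /andP[/negPf li /negPf lj]; rewrite ffunE li lj.
rewrite -comp_lfunE e comp_lfunE bvec_pair tensor_map_pure tensor_pow_bvec.
set w := pure _ _.
suff -> : slice (pure_pow (fun l => f l (bvec k (s l)))) x = P *: w.
  by rewrite linearZ_LR ffunE.
apply/ffunP=> q; rewrite ffunE pure_pow_split update2_l update2_r.
rewrite -surjective_pairing [RHS]ffunE; congr (_ * _).
by apply: eq_bigr => l /andP[/negPf li /negPf lj]; rewrite ffunE li lj.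
Qed.

Lemma act_at_monomial (c : 'End(k^[A * A])) (w : A * A -> k) (r : A * A -> A * A)
    (s : tpow A n) :
    (forall p, c (bvec k p) = w p *: bvec k (r p)) ->
  act_at c i j (bvec k s) =
    w (s i, s j) *: bvec k (update2 i j s (r (s i, s j))).
Proof.
move=> cE; rewrite lin_ext_bvec (bigD1 (r (s i, s j))) //= big1 => [|p np].
  by rewrite addr0 cE !ffunE eqxx /GRing.scale /= mulr1.
by rewrite cE !ffunE (negPf np) scaler0 scale0r.
Qed.

End TwoFactors.

(** * Alternating intertwiners and t-equivalence *)

Lemma gen_bij (A : finType) (c : 'End(k^[A * A])) n (i : 'I_n.-1) :
  bijective c -> bijective (gen c i).
Proof. by apply: act_at_bij; rewrite -val_eqE /= neq_ltn leqnn. Qed.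

(** Intertwining the generators suffices: their inverses and all words follow,
    and the braid equation for [d] is that for [c] transported along the
    invertible [U 3]. *)
Lemma intertwine_t_equivalent (A : finType) (c d : 'End(k^[A * A]))
    (U : forall n, 'End(k^[tpow A n])) :
    braiding c -> bijective d -> (forall n, bijective (U n)) ->
    (forall n (i : 'I_n.-1), U n \o gen c i = gen d i \o U n)%VF ->
  t_equivalent c d.
Proof.
move=> bc bd bU Ug; split=> //.
  split=> //; have [_ yb] := bc; have U0 := bij_lker0 (bU 3).
  apply: (can_inj (g := fun f => (f \o (U 3)^-1)%VF) (f := fun f => (f \o U 3)%VF)).
    by move=> f; rewrite -comp_lfunA lker0_compfV // comp_lfun1r.
  have Ug3 w i : (w \o gen d i \o U 3 = w \o U 3 \o gen c i)%VF.
    by rewrite -!comp_lfunA Ug.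
  rewrite /= !Ug3 -!Ug -!comp_lfunA; congr (_ \o _)%VF.
  by rewrite !comp_lfunA.
move=> n _; exists (U n) => // b; elim: b => [|[i e] b IH] /=.
  by rewrite comp_lfun1l comp_lfun1r.
rewrite comp_lfunA; case: e => /=; first by rewrite Ug -!comp_lfunA IH.
have [bij_c _] := bc.
by rewrite (intertwine_inv (gen_bij i bij_c) (gen_bij i bd) (Ug n i)) -!comp_lfunA IH.
Qed.

(** The intertwiner alternates [f^-1] and the identity.  At a generator in even
    position it acts through [f^-1 (x) 1], which intertwines [c] with the left
    conjugate; in odd position it acts through [1 (x) f^-1], which intertwines
    [c] with the right one. *)
Lemma conj_t_equivalent (A : finType) (f : 'End(k^[A])) (c : 'End(k^[A * A])) :
    bijective f -> braiding c -> conj_left f c = conj_right f c ->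
  t_equivalent c (conj_left f c).
Proof.
move=> bf bc lr; have f0 := bij_lker0 bf; have bV := lfun_inv_bij bf.
have b1 : bijective (\1%VF : 'End(k^[A])).
  by exists id => v; rewrite id_lfunE.
pose g n (l : 'I_n) : 'End(k^[A]) := if odd l then \1%VF else (f^-1)%VF.
apply: (@intertwine_t_equivalent _ _ _ (fun n => tensor_pow (g n))) => //.
- have [bij_c _] := bc.
  have [bl br] := (tensor_map_bij bV b1, tensor_map_bij bf b1).
  apply: (eq_bij (f := tensor_map f^-1 \1 \o (c \o tensor_map f \1))).
    exact: bij_comp bl (bij_comp bij_c br).
  by move=> v; rewrite /= !comp_lfunE.
- by move=> n; apply: tensor_pow_bij => l; rewrite /g; case: odd.
move=> n i; apply: act_at_intertwine; first by rewrite -val_eqE /= neq_ltn leqnn.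
rewrite /g /=; case: odd => /=; [rewrite lr /conj_right|rewrite /conj_left];
  rewrite -!comp_lfunA tensor_map_comp;
  by rewrite lker0_compfV // comp_lfun1l tensor_map1 comp_lfun1r.
Qed.

(** * Monomial braidings *)

Definition triple (A : Type) (x y z : A) : tpow A 3 :=
  [ffun l : 'I_3 => nth z [:: x; y] l].

Lemma triple_surj (A : Type) (s : tpow A 3) :
  exists x y z, s = triple x y z.
Proof.
exists (s (@Ordinal 3 0 isT)), (s (@Ordinal 3 1 isT)), (s (@Ordinal 3 2 isT)).
by apply/ffunP=> -[[|[|[|//]]] l3]; rewrite ffunE /=; congr (s _); apply/val_inj.
Qed.

Lemma gen12_monomial (A : finType) (c : 'End(k^[A * A])) (w : A * A -> k)
    (r : A * A -> A * A) x y z :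
    (forall p, c (bvec k p) = w p *: bvec k (r p)) ->
  gen c (ord0 : 'I_3.-1) (bvec k (triple x y z)) =
    w (x, y) *: bvec k (triple (r (x, y)).1 (r (x, y)).2 z).
Proof.
move=> cE; rewrite /gen (act_at_monomial _ _ _ cE) ![triple _ _ _ _]ffunE /=.
congr (_ *: bvec k _); apply/ffunP=> l; rewrite !ffunE -!val_eqE.
by case: l => [[|[|[|//]]] l3].
Qed.

Lemma gen23_monomial (A : finType) (c : 'End(k^[A * A])) (w : A * A -> k)
    (r : A * A -> A * A) x y z :
    (forall p, c (bvec k p) = w p *: bvec k (r p)) ->
  gen c (ord_max : 'I_3.-1) (bvec k (triple x y z)) =
    w (y, z) *: bvec k (triple x (r (y, z)).1 (r (y, z)).2).
Proof.
move=> cE; rewrite /gen (act_at_monomial _ _ _ cE) ![triple _ _ _ _]ffunE /=.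
congr (_ *: bvec k _); apply/ffunP=> l; rewrite !ffunE -!val_eqE.
by case: l => [[|[|[|//]]] l3].
Qed.

(** The set-theoretical Yang-Baxter equation for [r] matches the basis vectors of
    the two sides of the braid equation, so only the scalars have to agree. *)
Lemma monomial_braiding (A : finType) (r : A * A -> A * A) (w : A * A -> k)
    (c : 'End(k^[A * A])) :
    YB_solution r -> (forall p, w p != 0) ->
    (forall p, c (bvec k p) = w p *: bvec k (r p)) ->
    (forall x y z,
      let p := r (x, y) in let q := r (p.2, z) in
      let p' := r (y, z) in let q' := r (x, p'.1) in
      w (x, y) * w (p.2, z) * w (p.1, q.1) =
      w (y, z) * w (x, p'.1) * w (q'.2, p'.2)) ->
  braiding c.
Proof.
move=> [_ br yb] w0 cE w_yb; split; first exact: monomial_bij br w0 cE.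
have := fun x y z => gen23_monomial x y z cE.
have := fun x y z => gen12_monomial x y z cE.
move: (gen c _) (gen c _) => c23 c12 c12E c23E.
apply: eq_lin_bvec => s; have [x [y [z ->]]] := triple_surj s; rewrite !comp_lfunE.
have Z (f : 'End(k^[tpow A 3])) a v : f (a *: v) = a *: f v by exact: linearZ_LR.
rewrite c12E c23E !Z c12E c23E !Z c12E c23E !scalerA w_yb.
congr (_ *: bvec k _); move: (yb (x, y, z)) => /=.
case: (r (x, y)) (r (y, z)) => [x1 y1] [y2 z2] /=.
case: (r (y1, z)) (r (x, y2)) => [y3 z3] [x4 y4] /=.
by case: (r (x1, y3)) (r (y4, z2)) => [? ?] [? ?] /= [-> -> ->].
Qed.

End Tensor.

(** * Near-rack solutions and their twists *)

Section NearRack.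
Variables (X : finType) (r : X * X -> X * X) (t : X -> X).
Hypothesis nr : near_rack_solution r t.

Lemma near_rackE x y : r (x, y) = (sigma r x y, t x).
Proof. by case: nr => _ _ tE _ _; rewrite -(tE y) -surjective_pairing. Qed.

Lemma near_rackK : involutive t.
Proof. by case: nr. Qed.

(** First component of the Yang-Baxter equation. *)
Lemma sigma_comp x y z :
  sigma r x (sigma r y z) = sigma r (sigma r x y) (sigma r (t x) z).
Proof.
case: nr => -[_ _ yb] _ _ _ _; move: (yb (x, y, z)).
by rewrite /=; do 3!rewrite !near_rackE /=; case=> ->.
Qed.

(** Second component of the Yang-Baxter equation, which is the same for all values
    of the third variable. *)
Lemma tau_sigma x y : t (sigma r x y) = sigma r (t x) (t y).
Proof.
case: nr => -[_ _ yb] _ _ _ _; move: (yb (x, y, x)).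
by rewrite /=; do 3!rewrite !near_rackE /=; case=> _ ->.
Qed.

Lemma derived_near_rack x y : derived r (x, y) = (sigma r x (t y), x).
Proof.
case: (nr) => _ nd tE _ _; rewrite /derived /=.
have e : derived_T r (t x, y) = (x, y) by rewrite /derived_T /= tE near_rackK.
rewrite -{1}e (finv_f (derived_T_inj nd)) near_rackE /derived_T /=.
by rewrite tE tau_sigma near_rackK.
Qed.

(** Moving [t] inwards turns self-distributivity into
    [sigma_x sigma_(t y) = sigma_(sigma_x (t y)) sigma_(t x)], which is
    [sigma_comp]. *)
Lemma near_rack_rack : rack (fun x y => sigma r x (t y)).
Proof.
case: (nr) => _ [bs _] _ _ _; split=> [x|x y z].
  exact: bij_comp (bs x) (inv_bij near_rackK).
by rewrite !tau_sigma !near_rackK sigma_comp.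
Qed.

Variable k : fieldType.

Lemma near_rack_braidingP (R : X -> X -> k) (c : 'End(k^[X * X])) :
  near_rack_braiding r t R c -> braiding c.
Proof.
move=> [R0 Rc cE]; case: nr => yb _ _ _ _.
apply: (@monomial_braiding _ _ r (fun p => R p.1 p.2)) => //.
  by move=> [i j]; rewrite bvec_pair cE near_rackE bvec_pair.
by move=> x y z; rewrite /= !near_rackE /= Rc.
Qed.

Variables (z : X -> k).
Hypothesis z0 : forall i, z i != 0.
Let phi := twist t z.

Lemma twist_bvec i : phi (bvec k i) = z i *: bvec k (t i).
Proof. exact: lin_ext_bvec. Qed.

Lemma twist_bij : bijective phi.
Proof. exact: monomial_bij (inv_bij near_rackK) z0 twist_bvec. Qed.

Lemma twist_inv_bvec i : (phi^-1)%VF (bvec k i) = (z (t i))^-1 *: bvec k (t i).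
Proof.
have pK := lker0_lfunK (bij_lker0 twist_bij).
rewrite -[RHS]pK linearZ_LR /= twist_bvec near_rackK.
by rewrite scalerA mulVf ?scale1r.
Qed.

Variables (R : X -> X -> k) (c : 'End(k^[X * X])).
Hypothesis hc : near_rack_braiding r t R c.

Lemma conj_left_twist i j :
  conj_left phi c (pure (bvec k i) (bvec k j)) =
    (z i * R (t i) j / z (sigma r i (t j))) *:
      pure (bvec k (sigma r i (t j))) (bvec k i).
Proof.
case: hc => _ _ cE; rewrite !comp_lfunE tensor_map_pure id_lfunE twist_bvec.
rewrite pureZl !linearZ_LR /= cE linearZ_LR /= tensor_map_pure id_lfunE.
by rewrite twist_inv_bvec tau_sigma near_rackK pureZl !scalerA.
Qed.

Lemma conj_right_twist i j :
  conj_right phi c (pure (bvec k i) (bvec k j)) =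
    (z j * R i (t j) / z i) *: pure (bvec k (sigma r i (t j))) (bvec k i).
Proof.
case: hc => _ _ cE; rewrite !comp_lfunE tensor_map_pure id_lfunE twist_bvec.
rewrite pureZr !linearZ_LR /= cE linearZ_LR /= tensor_map_pure id_lfunE.
by rewrite twist_inv_bvec near_rackK pureZr !scalerA.
Qed.

(** Both conjugates are multiples of the same basis tensor, so they agree exactly
    when their coefficients do. *)
Lemma conj_twist_eq :
  conj_left phi c = conj_right phi c <->
  (forall i j,
    z i ^+ 2 = z j * z (sigma r i (t j)) * (R i (t j) / R (t i) j)).
Proof.
have R0 := near_rack_braiding_neq0 hc.
have eqE i j :
  (z i * R (t i) j / z (sigma r i (t j)) == z j * R i (t j) / z i) =
  (z i ^+ 2 == z j * z (sigma r i (t j)) * (R i (t j) / R (t i) j)).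
  rewrite eqr_div // mulrA -[z i ^+ 2]divr1 eqr_div ?oner_eq0 //.
  by rewrite mulr1 expr2 mulrAC [z j * R i _ * _]mulrAC.
split=> [e i j|e].
  apply/eqP; rewrite -eqE; apply/eqP.
  move: (congr1 (fun f : 'End(_) => f (pure (bvec k i) (bvec k j))) e).
  by rewrite conj_left_twist conj_right_twist -bvec_pair => /scale_bvec_inj.
apply: eq_lin_bvec => -[i j]; rewrite bvec_pair conj_left_twist conj_right_twist.
by congr (_ *: _); apply/eqP; rewrite eqE; apply/eqP.
Qed.

End NearRack.

Unset Implicit Arguments.

Theorem theorem4p2 (k : closedFieldType) (k0 : [pchar k] =i pred0)
    (X : finType) (r : X * X -> X * X) (t : X -> X)
    (nr : near_rack_solution r t)
    (R : X -> X -> k) (c : 'End({ffun X * X -> k^o}))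
    (hc : near_rack_braiding r t R c)
    (z : X -> k) (z0 : forall i, z i != 0) :
  let phi := twist t z in
  let z_eqs := forall i j,
    z i ^+ 2 = z j * z (sigma r i (t j)) * (R i (t j) / R (t i) j) in
  [/\ bijective phi,
      conj_left phi c = conj_right phi c <-> z_eqs &
      z_eqs ->
        t_equivalent c (conj_left phi c) /\
        rack_type_braiding (derived r) (conj_left phi c)].
Proof.
move=> phi z_eqs.
have phi_bij : bijective phi := twist_bij nr z0.
have lr : conj_left phi c = conj_right phi c <-> z_eqs := conj_twist_eq nr z0 hc.
split=> // /lr clr.
have te := conj_t_equivalent phi_bij (near_rack_braidingP nr hc) clr.
split=> //; split; first by case: te.
exists (fun x y => sigma r x (t y)),
  (fun i j => z i * R (t i) j / z (sigma r i (t j))).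
split; [exact: near_rack_rack nr | exact: derived_near_rack nr | |].
  by move=> i j; rewrite !mulf_neq0 ?invr_neq0 ?z0 ?(near_rack_braiding_neq0 hc).
by move=> i j; rewrite (conj_left_twist nr z0 hc).
Qed.
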